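(* Let $\mathbb{K}$ be a field and let $\mathcal{K}\colon K_0\to K_1\to\cdots\to K_N$ be a finite sequence of maps between topological spaces whose homology with coefficients in $\mathbb{K}$ is finite dimensional in each degree. Given $n\ge1$ and $p\ge0$, there exists a basis $\mathcal{B}$ of $H(\mathcal{K})=\bigoplus_{i=0}^N H_*(K_i)$ such that, for any $0\le i\le j\le N$, $$\dim(\Delta_n)^{i,j}_p(\mathcal{K})=\#\{\beta\in\mathcal{B}\cap H_p(K_i)\;:\;\beta\text{ is }\Delta_n\text{-awake at }K_k\text{ for all }k=i,\dots,j\}.$$
   Context: Homology is singular homology with coefficients in the field $\mathbb{K}$. For $i\le j$, $f^{i,j}\colon H_*(K_i)\to H_*(K_j)$ is the map induced by the composition $K_i\to\cdots\to K_j$ (with $f^{i,i}=\mathrm{id}$), and $f^{i,j}_p\colon H_p(K_i)\to H_p(K_j)$ is its degree $p$ part. An $A_\infty$-coalgebra structure $(M,\{\Delta_n\}_{n\ge1})$ on a graded module $M$ is a sequence of morphisms $\Delta_n\colon M\to M^{\otimes n}$ of degree $n-2$ such that for all $n\ge1$ $$\sum_{i=1}^n\sum_{k=0}^{n-i}(-1)^{i+k+ik}\left(1^{\otimes n-i-k}\otimes\Delta_i\otimes 1^{\otimes k}\right)\Delta_{n-i+1}=0.$$ Each $H_*(K_i)$ is endowed with a fixed $A_\infty$-coalgebra structure $\{\Delta_n^i\}_{n\ge1}$ (written simply $\Delta_n$) with $\Delta_1=0$, namely the one obtained by the homotopy transfer theorem (perturbation lemma) from the differential graded coalgebra of singular chains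 $C_*(K_i)$ with the Alexander-Whitney diagonal, along chain maps $p\colon C_*(K_i)\to(H_*(K_i),0)$, $\iota\colon(H_*(K_i),0)\to C_*(K_i)$ and a chain homotopy $\phi$ with $p\iota=\mathrm{id}$, $p\phi=\phi\iota=\phi^2=0$, $\phi d+d\phi=\iota p-\mathrm{id}$. For $0\le i\le j\le N$ and $p\ge0$, the $p$-th $\Delta_n$-persistent group between $K_i$ and $K_j$ is $$(\Delta_n)_p^{i,j}(\mathcal{K})=f^{i,j}_p\Bigl(\bigcap_{k=i}^j\ker\bigl(\Delta_n\circ f^{i,k}_p\bigr)\Bigr)\subset H_p(K_j).$$ A non-zero class $\alpha\in H_p(K_i)$ is $\Delta_n$-awake at $K_j$ ($i\le j$) if $f^{i,j}\alpha\ne0$ and $\Delta_n f^{i,j}\alpha=0$. *)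

(* Defs.v *)
From HB Require Import structures.
From mathcomp Require Import all_boot all_order all_algebra.
From mathcomp Require Import ring_quotient generic_quotient.
From mathcomp Require Import all_classical all_reals all_analysis.
From mathcomp Require Import freeg.

Set Implicit Arguments.
Unset Strict Implicit.
Unset Printing Implicit Defensive.

Import Order.TTheory GRing.Theory Num.Theory.
Import numFieldNormedType.Exports.
Import ring_quotient.Quotient.

Local Open Scope classical_set_scope.
Local Open Scope ring_scope.
Local Open Scope quotient_scope.

(** * Bases and dimensions in possibly infinite-dimensional spaces *)

Section Bases.
Context (F : fieldType) (V : lmodType F).

Definition lin_indep (B : set V) : Prop :=
  forall (s : seq V) (c : V -> F), uniq s -> (forall v, v \in s -> B v) ->
    \sum_(v <- s) c v *: v = 0 -> forall v, v \in s -> c v = 0.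

Definition lin_span (B : set V) : set V :=
  [set w | exists (s : seq V) (c : V -> F),
     (forall v, v \in s -> B v) /\ w = \sum_(v <- s) c v *: v].

Definition set_basis_of (W B : set V) : Prop :=
  [/\ B `<=` W, lin_indep B & W `<=` lin_span B].

Definition finite_dim (W : set V) : Prop :=
  exists2 B, set_basis_of W B & finite_set B.

Definition has_dim (W : set V) (d : nat) : Prop :=
  exists2 B, set_basis_of W B & (B #= `I_d)%card.

End Bases.

(** * Finite direct sums *)

Definition dirsum (F : fieldType) (I : finType) (V : I -> lmodType F) : Type :=
  forall i, V i.

Section DirectSum.
Context (F : fieldType) (I : finType) (V : I -> lmodType F).
Implicit Types x y z : dirsum V.

HB.instance Definition _ := gen_eqMixin (dirsum V).
HB.instance Definition _ := gen_choiceMixin (dirsum V).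

Definition ds0 : dirsum V := fun=> 0.
Definition dsopp x : dirsum V := fun i => - x i.
Definition dsadd x y : dirsum V := fun i => x i + y i.
Definition dsscale (a : F) x : dirsum V := fun i => a *: x i.

Lemma dsaddA : associative dsadd.
Proof. by move=> x y z; apply: functional_extensionality_dep => i; exact: addrA. Qed.
Lemma dsaddC : commutative dsadd.
Proof. by move=> x y; apply: functional_extensionality_dep => i; exact: addrC. Qed.
Lemma dsadd0 : left_id ds0 dsadd.
Proof. by move=> x; apply: functional_extensionality_dep => i; exact: add0r. Qed.
Lemma dsaddN : left_inverse ds0 dsopp dsadd.
Proof. by move=> x; apply: functional_extensionality_dep => i; exact: addNr. Qed.

HB.instance Definition _ :=
  GRing.isZmodule.Build (dirsum V) dsaddA dsaddC dsadd0 dsaddN.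

Lemma dsscaleA a b x : dsscale a (dsscale b x) = dsscale (a * b) x.
Proof. by apply: functional_extensionality_dep => i; exact: scalerA. Qed.
Lemma dsscale1 : left_id 1 dsscale.
Proof. by move=> x; apply: functional_extensionality_dep => i; exact: scale1r. Qed.
Lemma dsscaleDr : right_distributive dsscale +%R.
Proof.
by move=> a x y; apply: functional_extensionality_dep => i; exact: scalerDr.
Qed.
Lemma dsscaleDl x : {morph dsscale^~ x : a b / a + b}.
Proof.
by move=> a b; apply: functional_extensionality_dep => i; exact: scalerDl.
Qed.

HB.instance Definition _ := GRing.Zmodule_isLmodule.Build F (dirsum V)
  dsscaleA dsscale1 dsscaleDr dsscaleDl.

Definition dsinj (i : I) (v : V i) : dirsum V := fun j =>
  if @eqP _ i j is ReflectT e then ecast j (V j) e v else 0.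

End DirectSum.

Arguments dsinj {F I} V i v.

(** * Free modules *)

Section Free.
Context (F : fieldType) (S : choiceType) (W : lmodType F) (f : S -> W).

Lemma fglift_linear : linear (fglift f : {freeg S / F} -> W).
Proof.
have fD := @lift_is_additive F S W f.
have f0 : fglift f 0 = 0 by rewrite -(subrr 0) fD subrr.
have fN x : fglift f (- x) = - fglift f x by rewrite -(sub0r x) fD f0 sub0r.
have fA x y : fglift f (x + y) = fglift f x + fglift f y.
  by rewrite -{1}(opprK y) fD fN opprK.
have fS (s : seq S) (h : S -> {freeg S / F}) :
    fglift f (\sum_(x <- s) h x) = \sum_(x <- s) fglift f (h x).
  by elim: s => [|a s IHs]; rewrite ?big_nil // !big_cons fA IHs.
move=> a x y; rewrite fA; congr (_ + _).
rewrite -{2}(freeg_sumE x) fS scaler_sumr [a *: x]/GRing.scale /= /fgscale fS.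
by apply: eq_bigr => s _; rewrite !liftU scalerA.
Qed.

HB.instance Definition _ := GRing.isLinear.Build F {freeg S / F} W *:%R
  (fglift f) fglift_linear.

End Free.

(** * Quotient modules *)

Record subspace (F : fieldType) (V : lmodType F) := Subspace {
  subspace_mem : V -> bool;
  subspaceP : submod_closed (subspace_mem : {pred V})
}.

Section QuotientModule.
Context (F : fieldType) (V : lmodType F) (I : subspace V).
Local Notation mem := (subspace_mem I).

Lemma subspace0 : mem 0. Proof. exact: (subspaceP I).1. Qed.

Lemma subspaceL a x y : mem x -> mem y -> mem (a *: x + y).
Proof. by move=> Ix Iy; apply: (subspaceP I).2. Qed.

Lemma subspaceZ a x : mem x -> mem (a *: x).
Proof. by move=> Ix; rewrite -[_ *: _]addr0; apply: subspaceL (subspace0). Qed.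

Lemma subspace_zmod_closed : zmod_closed (mem : {pred V}).
Proof.
split=> [|x y Ix Iy]; first exact: subspace0.
by rewrite addrC -scaleN1r; exact: subspaceL.
Qed.

HB.instance Definition _ := GRing.isZmodClosed.Build V mem subspace_zmod_closed.

Definition subspace_zmod : zmodClosed V := GRing.ZmodClosed.clone V mem _.

Definition quot_mod : Type := {quot subspace_zmod}.
HB.instance Definition _ := GRing.Zmodule.on quot_mod.

Definition qpi (v : V) : quot_mod := \pi_({quot subspace_zmod}) v.
Definition qrepr (x : quot_mod) : V := repr (x : {quot subspace_zmod}).

Lemma qreprK x : qpi (qrepr x) = x. Proof. exact: reprK. Qed.

Lemma qpi_eq u v : (qpi u = qpi v) <-> mem (u - v).
Proof.
by rewrite -[mem _]/(u - v \in (mem : {pred V})) idealrBE; split=> /eqP.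
Qed.

Lemma qpiD u v : qpi (u + v) = qpi u + qpi v.
Proof. exact: (raddfD (\pi_({quot subspace_zmod}))). Qed.

Definition qscale (a : F) (x : quot_mod) : quot_mod := qpi (a *: qrepr x).

Lemma qscale_pi a v : qscale a (qpi v) = qpi (a *: v).
Proof.
apply/qpi_eq; rewrite -scalerBr; apply: subspaceZ.
by apply/qpi_eq; rewrite qreprK.
Qed.

Lemma qscaleA a b x : qscale a (qscale b x) = qscale (a * b) x.
Proof. by rewrite -[x]qreprK !qscale_pi scalerA. Qed.
Lemma qscale1 : left_id 1 qscale.
Proof. by move=> x; rewrite -[x]qreprK qscale_pi scale1r. Qed.
Lemma qscaleDr : right_distributive qscale +%R.
Proof.
by move=> a x y; rewrite -[x]qreprK -[y]qreprK -qpiD !qscale_pi scalerDr qpiD.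
Qed.
Lemma qscaleDl x : {morph qscale^~ x : a b / a + b}.
Proof. by move=> a b; rewrite -[x]qreprK !qscale_pi scalerDl qpiD. Qed.

HB.instance Definition _ := GRing.Zmodule_isLmodule.Build F quot_mod
  qscaleA qscale1 qscaleDr qscaleDl.

Lemma qpi_linear : linear qpi.
Proof. by move=> a u v; rewrite qpiD; congr (_ + _); rewrite -qscale_pi. Qed.

HB.instance Definition _ := GRing.isLinear.Build F V quot_mod *:%R
  qpi qpi_linear.

(* The map [quot_mod -> W] induced by [g]; meaningful when [g] vanishes on
   the subspace. *)
Definition qlift (W : lmodType F) (g : V -> W) (x : quot_mod) : W := g (qrepr x).

Section Lift.
Context (W : lmodType F) (g : V -> W).
Hypothesis g_lin : linear g.
Hypothesis g_I : forall v, mem v -> g v = 0.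

Lemma qlift_pi v : qlift g (qpi v) = g v.
Proof.
have : mem (qrepr (qpi v) - v) by apply/qpi_eq; rewrite qreprK.
move=> /g_I; rewrite addrC -scaleN1r g_lin scaleN1r => /eqP.
by rewrite addrC subr_eq0 => /eqP.
Qed.

Lemma qlift_linear : linear (qlift g).
Proof.
move=> a x y; rewrite -[x in LHS]qreprK -[y in LHS]qreprK -qpi_linear.
by rewrite qlift_pi g_lin.
Qed.

End Lift.
End QuotientModule.

Arguments qpi {F V} I v.

(** * The tensor algebra *)

(* [tensor V] is the free module on the words [v1 ... vn] of vectors modulo
   multilinearity. The tensor power of [V] of order [n] is its summand spanned
   by the words of length [n], and the word [v1 ... vn] stands for
   the tensor product of the [vi]. *)

Section Tensor.
Context (F : fieldType) (V : lmodType F).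
Local Notation words := {freeg (seq V) / F}.

Definition multilin_rel (s t : seq V) (a : F) (u v : V) : words :=
  << s ++ (a *: u + v) :: t >> - a *: << s ++ u :: t >> - << s ++ v :: t >>.

Inductive tensor_rel : words -> Prop :=
| tensor_rel0 : tensor_rel 0
| tensor_relD s t a u v b x :
    tensor_rel x -> tensor_rel (b *: multilin_rel s t a u v + x).

Lemma tensor_rel_closed :
  submod_closed ((fun x => `[< tensor_rel x >]) : {pred words}).
Proof.
split=> [|b x y]; first exact/asboolP/tensor_rel0.
move=> /asboolP xR /asboolP yR; apply/asboolP.
elim: xR => [|s t a u v c z _ IH]; first by rewrite scaler0 add0r.
by rewrite scalerDr scalerA -addrA; exact: tensor_relD.
Qed.

Definition tensor_ideal : subspace words := Subspace tensor_rel_closed.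

Definition tensor : Type := quot_mod tensor_ideal.
HB.instance Definition _ := GRing.Lmodule.on tensor.

Definition tword (s : seq V) : tensor := qpi tensor_ideal << s >>.

Lemma tword_multilin s t a u v :
  tword (s ++ (a *: u + v) :: t) = a *: tword (s ++ u :: t) + tword (s ++ v :: t).
Proof.
rewrite /tword -linearP; apply/qpi_eq/asboolP; rewrite opprD addrA.
by rewrite -[X in tensor_rel X]addr0 -[X in X + 0]scale1r;
   exact/tensor_relD/tensor_rel0.
Qed.

(* The linear map with value [g s] on the word [s]; meaningful when [g] is
   multilinear. *)
Definition tlift (W : lmodType F) (g : seq V -> W) : tensor -> W :=
  qlift (fglift g : words -> W).

Definition multilin (W : lmodType F) (g : seq V -> W) : Prop :=
  forall s t a u v,
    g (s ++ (a *: u + v) :: t) = a *: g (s ++ u :: t) + g (s ++ v :: t).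

Section Lift.
Context (W : lmodType F) (g : seq V -> W).
Hypothesis g_ml : multilin g.

Lemma fglift_tensor_rel x :
  subspace_mem tensor_ideal x -> fglift g x = 0 :> W.
Proof.
move=> /asboolP; elim=> [|s t a u v b y _ IH]; first by rewrite linear0.
rewrite linearP /= IH addr0 !(raddfB (fglift g)) /=.
rewrite (linearZ_LR (fglift g)) /= !liftU !scale1r g_ml.
by rewrite addrAC addrK subrr scaler0.
Qed.

Lemma tlift_linear : linear (tlift g).
Proof. apply: qlift_linear; [exact: linearP | exact: fglift_tensor_rel]. Qed.

Lemma tlift_word s : tlift g (tword s) = g s.
Proof.
rewrite /tlift qlift_pi; [|exact: linearP|exact: fglift_tensor_rel].
by rewrite liftU scale1r.
Qed.

End Lift.

Definition tmul (x y : tensor) : tensor :=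
  tlift (fun s => tlift (fun t => tword (s ++ t)) y) x.

Lemma tmul_multilinr s : multilin (fun t => tword (s ++ t)).
Proof. by move=> s1 s2 a u v; rewrite !catA tword_multilin. Qed.

Lemma tensor_ind (P : tensor -> Prop) :
  P 0 -> (forall a s x, P x -> P (a *: tword s + x)) -> forall x, P x.
Proof.
move=> P0 PD x; rewrite -[x]qreprK -[qrepr x]freeg_sumE.
elim: (dom _) => [|s r IH].
  by rewrite big_nil linear0.
rewrite big_cons linearD /=.
have -> : << coeff s (qrepr x) *g s >> = coeff s (qrepr x) *: << s >> :> words.
  apply/eqP/freeg_eqP => z; rewrite coeffZ !coeffU mul1r //.
by rewrite linearZ; exact: PD.
Qed.

Lemma tmul_multilinl y :
  multilin (fun s => tlift (fun t => tword (s ++ t)) y).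
Proof.
move=> s1 s2 a u v; have L s := tlift_linear (tmul_multilinr s).
have L0 s : tlift (fun t => tword (s ++ t)) 0 = 0.
  by have := L s (-1) 0 0; rewrite scaler0 addr0 scaleN1r addNr.
elim/tensor_ind: y => [|b t y IH]; first by rewrite !L0 scaler0 addr0.
rewrite !L IH !tlift_word; try exact: tmul_multilinr.
rewrite -!catA /= tword_multilin !scalerDr !scalerA mulrC -!addrA.
by congr (_ + _); rewrite addrCA.
Qed.

Lemma tmul_word s t : tmul (tword s) (tword t) = tword (s ++ t).
Proof.
rewrite /tmul tlift_word; last exact: tmul_multilinl.
by rewrite tlift_word; last exact: tmul_multilinr.
Qed.

Lemma tmul_linl y : linear (tmul^~ y).
Proof. exact/tlift_linear/tmul_multilinl. Qed.

Lemma tmul_linr x : linear (tmul x).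
Proof.
move=> b y z; rewrite /tmul.
have L s := tlift_linear (tmul_multilinr s).
have Ll w := tlift_linear (tmul_multilinl w).
have L0 w : tlift (fun s => tlift (fun t => tword (s ++ t)) w) 0 = 0.
  by have := Ll w (-1) 0 0; rewrite scaler0 addr0 scaleN1r addNr.
elim/tensor_ind: x => [|a s x IH]; first by rewrite !L0 scaler0 addr0.
rewrite !Ll IH !tlift_word; try exact: tmul_multilinl.
rewrite L !scalerDr !scalerA mulrC -!addrA.
by congr (_ + _); rewrite addrCA.
Qed.

End Tensor.

(* [(f (x) g) x] for a tensor [x] of order 2. *)
Definition tmap2 (F : fieldType) (V W : lmodType F) (f g : V -> tensor W)
    (x : tensor V) : tensor W :=
  tlift (fun s => if s is [:: a; b] then tmul (f a) (g b) else 0) x.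

Lemma tmap2_linear (F : fieldType) (V W : lmodType F) (f g : V -> tensor W) :
  linear f -> linear g -> linear (tmap2 f g).
Proof.
move=> fL gL; apply: tlift_linear.
case=> [|x [|y s]] t a u v /=.
- case: t => [|b [|? ?]]; rewrite ?scaler0 ?addr0 //.
  by rewrite fL tmul_linl.
- case: t => [|? ?]; rewrite ?scaler0 ?addr0 //.
  by rewrite gL tmul_linr.
- by case: s => [|? ?] /=; rewrite scaler0 addr0.
Qed.

(** * Homology of a module with an endomorphism *)

Section Homology.
Context (F : fieldType) (C : lmodType F) (d : {linear C -> C}).

Lemma cycles_closed : submod_closed ((fun x => d x == 0) : {pred C}).
Proof.
split=> [|a x y]; rewrite ?inE /in_mem /=; first by rewrite linear0.
by move=> /eqP dx /eqP dy; rewrite linearP /= dx dy scaler0 addr0.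
Qed.

Definition is_cycle (x : C) : bool := d x == 0.
HB.instance Definition _ := GRing.isSubmodClosed.Build F C is_cycle cycles_closed.

Record cycle := Cycle { cycle_val : C; _ : is_cycle cycle_val }.
HB.instance Definition _ := [isSub for cycle_val].
HB.instance Definition _ := [Choice of cycle by <:].
HB.instance Definition _ := [SubChoice_isSubLmodule of cycle by <:].

Lemma boundaries_closed :
  submod_closed ((fun z => `[< exists y, d y = cycle_val z >]) : {pred cycle}).
Proof.
split=> [|a z z']; first by apply/asboolP; exists 0; rewrite linear0.
move=> /asboolP[y dy] /asboolP[y' dy']; apply/asboolP.
by exists (a *: y + y'); rewrite linearP /= dy dy'.
Qed.

Definition boundaries : subspace cycle := Subspace boundaries_closed.

Definition homology : Type := quot_mod boundaries.
HB.instance Definition _ := GRing.Lmodule.on homology.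

Definition hclass (z : cycle) : homology := qpi boundaries z.

End Homology.

Section HomologyMap.
Context (F : fieldType) (C C' : lmodType F).
Context (d : {linear C -> C}) (d' : {linear C' -> C'}) (f : {linear C -> C'}).

(* The default value [0] is never used when [f] is a chain map. *)
Definition cycle_map (z : cycle d) : cycle d' := insubd 0 (f (cycle_val z)).

Definition homology_map : homology d -> homology d' :=
  qlift (fun z => hclass (cycle_map z)).

Hypothesis fd : forall x, f (d x) = d' (f x).

Lemma cycle_mapE z : cycle_val (cycle_map z) = f (cycle_val z).
Proof.
apply: insubdK; rewrite -topredE /= /is_cycle -fd.
by case: z => z /= /eqP ->; rewrite linear0.
Qed.

Lemma cycle_map_linear : linear cycle_map.
Proof.
move=> a x y; apply: val_inj.
by rewrite /= cycle_mapE /= linearP /= -!cycle_mapE.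
Qed.

Lemma hclass_cycle_map_linear : linear (fun z => hclass (cycle_map z)).
Proof. by move=> a x y; rewrite /hclass cycle_map_linear linearP. Qed.

Lemma hclass_boundary (z : cycle d) :
  subspace_mem (boundaries d) z -> hclass (cycle_map z) = 0.
Proof.
move=> /asboolP[y dy]; rewrite /hclass -(linear0 (qpi (boundaries d'))).
apply/qpi_eq; rewrite subr0; apply/asboolP; exists (f y).
by rewrite -fd dy cycle_mapE.
Qed.

Lemma homology_map_linear : linear homology_map.
Proof.
exact: (qlift_linear hclass_cycle_map_linear hclass_boundary).
Qed.

Lemma homology_map_class z : homology_map (hclass z) = hclass (cycle_map z).
Proof. exact: (qlift_pi hclass_cycle_map_linear hclass_boundary). Qed.

End HomologyMap.

(** * Singular simplices *)

Section Simplices.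
Context (R : realType).

Definition simplex (n : nat) : set 'rV[R]_n.+1 :=
  [set x | (forall i, 0 <= x 0 i) /\ \sum_i x 0 i = 1].
Arguments simplex : clear implicits.

(* The affine map sending the vertex [i] to the vertex [theta i]. *)
Definition vertex_mx m n (theta : 'I_m.+1 -> 'I_n.+1) (x : 'rV[R]_m.+1) :
    'rV[R]_n.+1 :=
  \row_j \sum_(i | theta i == j) x 0 i.

Lemma vertex_mx_simplex m n (theta : 'I_m.+1 -> 'I_n.+1) (x : simplex m) :
  vertex_mx theta (set_val x) \in simplex n.
Proof.
case: x => x /= xS; move: (set_mem xS) => -[x0 x1].
rewrite inE; split=> [j|]; first by rewrite mxE sumr_ge0.
by rewrite -x1 (partition_big theta xpredT) //=; apply: eq_bigr => j _; rewrite mxE.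
Qed.

Definition simplex_map m n (theta : 'I_m.+1 -> 'I_n.+1) (x : simplex m) :
    simplex n :=
  exist _ (vertex_mx theta (set_val x)) (vertex_mx_simplex theta x).

Lemma vertex_mx_continuous m n (theta : 'I_m.+1 -> 'I_n.+1) :
  continuous (vertex_mx theta).
Proof.
move=> x U [P Px PU].
have cont j : continuous (fun y : 'rV[R]_m.+1 => vertex_mx theta y 0 j).
  have -> : (fun y : 'rV[R]_m.+1 => vertex_mx theta y 0 j) =
      (fun y => \sum_(i | theta i == j) y 0 i).
    by apply/funext => y; rewrite mxE.
  apply: (@continuous_big R _ +%R 0) => [|i _]; first exact: (@add_continuous R^o).
  exact: coord_continuous.
have nP j : nbhs x [set y | P 0 j (vertex_mx theta y 0 j)].
  exact/(cont j)/Px.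
apply: filterS (@filter_forall _ _ _ (nbhs x) _ nP) => y Py; apply: PU => i j.
by rewrite [i]ord1; exact: Py.
Qed.

Lemma simplex_map_continuous m n (theta : 'I_m.+1 -> 'I_n.+1) :
  continuous (simplex_map theta).
Proof.
apply: continuous_comp_initial => x.
apply: (@continuous_comp _ _ _ set_val (vertex_mx theta)).
  exact: initial_continuous.
exact: vertex_mx_continuous.
Qed.

HB.instance Definition _ m n (theta : 'I_m.+1 -> 'I_n.+1) :=
  @isContinuous.Build (simplex m) (simplex n) (simplex_map theta)
    (@simplex_map_continuous m n theta).

Definition singular_simplex (n : nat) (X : topologicalType) : choiceType :=
  continuousType (simplex n) X.

Definition sing (X : topologicalType) : choiceType :=
  {n : nat & singular_simplex n X}.

Definition sub_simplex (X : topologicalType) m n (theta : 'I_m.+1 -> 'I_n.+1)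
    (s : singular_simplex n X) : sing X :=
  Tagged (singular_simplex^~ X) (s \o simplex_map theta : singular_simplex m X).

Definition sing_map (X Y : topologicalType) (f : continuousType X Y) (s : sing X) :
    sing Y :=
  Tagged (singular_simplex^~ Y) (f \o tagged s : singular_simplex (tag s) Y).

End Simplices.

Arguments simplex : clear implicits.
Arguments singular_simplex : clear implicits.
Arguments sing : clear implicits.

(** * Singular chains and singular homology *)

Section Chains.
Context (R : realType) (F : fieldType).

(* The module of singular chains of all degrees. *)
Definition chain (X : topologicalType) : lmodType F := {freeg (sing R X) / F}.

Definition chain_deg (X : topologicalType) (p : nat) : set (chain X) :=
  [set x | forall s, coeff s x != 0 -> tag s = p].

Definition simplex_boundary (X : topologicalType) (s : sing R X) : chain X :=
  let: existT n sigma := s in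
  match n return singular_simplex R n X -> chain X with
  | 0 => fun=> 0
  | m.+1 => fun sigma =>
      \sum_(k < m.+2) (-1) ^+ k *: << sub_simplex (fintype.lift k) sigma >>
  end sigma.

Definition sing_boundary (X : topologicalType) : {linear chain X -> chain X} :=
  fglift (@simplex_boundary X).

Definition chain_map (X Y : topologicalType) (f : continuousType X Y) :
    {linear chain X -> chain Y} :=
  fglift (fun s => << sing_map f s >> : chain Y).

Lemma sing_map_sub (X Y : topologicalType) (f : continuousType X Y) m n
    (theta : 'I_m.+1 -> 'I_n.+1) (sigma : singular_simplex R n X) :
  sing_map f (sub_simplex theta sigma) =
  sub_simplex theta (f \o sigma : singular_simplex R n Y).
Proof. by congr (Tagged _ _); exact/continuousEP. Qed.

Lemma chain_map_boundary (X Y : topologicalType) (f : continuousType X Y)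
    (x : chain X) :
  chain_map f (sing_boundary X x) = sing_boundary Y (chain_map f x).
Proof.
rewrite -[x]freeg_sumE; elim: (dom x) => [|s r IH].
  by rewrite big_nil !linear0.
rewrite big_cons !linearD /= IH; congr (_ + _).
rewrite /= !liftU !(linearZ_LR (fglift _)) /= liftU scale1r; congr (_ *: _).
case: s {IH} => -[|n] sigma /=; first by rewrite linear0.
rewrite linear_sum; apply: eq_bigr => k _.
by rewrite linearZ /= liftU scale1r sing_map_sub.
Qed.

Definition Hsing (X : topologicalType) : lmodType F := homology (sing_boundary X).

(* The summand of degree [p] of the homology. *)
Definition H_deg (X : topologicalType) (p : nat) : set (Hsing X) :=
  [set hclass z |
     z in [set z : cycle (sing_boundary X) | chain_deg p (cycle_val z)]].

Definition H_map (X Y : topologicalType) (f : continuousType X Y) :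
    Hsing X -> Hsing Y :=
  @homology_map _ _ _ (sing_boundary X) (sing_boundary Y) (chain_map f).

Lemma H_map_linear (X Y : topologicalType) (f : continuousType X Y) :
  linear (H_map f).
Proof. exact/homology_map_linear/chain_map_boundary. Qed.

HB.instance Definition _ (X Y : topologicalType) (f : continuousType X Y) :=
  GRing.isLinear.Build F (Hsing X) (Hsing Y) *:%R (H_map f) (H_map_linear f).

(** * The Alexander-Whitney diagonal *)

Definition front (X : topologicalType) (n k : nat)
    (sigma : singular_simplex R n X) : sing R X :=
  sub_simplex (fun i : 'I_k.+1 => inord i : 'I_n.+1) sigma.

Definition back (X : topologicalType) (n k : nat)
    (sigma : singular_simplex R n X) : sing R X :=
  sub_simplex (fun i : 'I_(n - k).+1 => inord (k + i)%N : 'I_n.+1) sigma.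

Definition aw_diagonal (X : topologicalType) : {linear chain X -> tensor (chain X)} :=
  fglift (fun s : sing R X => \sum_(k < (tag s).+1)
    tword [:: << front k (tagged s) >>; << back k (tagged s) >>]).

(* [x |-> (-1)^p x] on chains of degree [p]. *)
Definition parity (X : topologicalType) : {linear chain X -> chain X} :=
  fglift (fun s : sing R X => (-1) ^+ tag s *: << s >>).

(** * Homotopy transfer *)

Record chain_contraction (X : topologicalType) := ChainContraction {
  ct_p : {linear chain X -> Hsing X};
  ct_i : {linear Hsing X -> chain X};
  ct_h : {linear chain X -> chain X};
  ct_p_deg : forall q x, chain_deg q x -> H_deg q (ct_p x);
  ct_i_deg : forall q a, H_deg q a -> chain_deg q (ct_i a);
  ct_h_deg : forall q x, chain_deg q x -> chain_deg q.+1 (ct_h x);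
  ct_pd : forall x, ct_p (sing_boundary X x) = 0;
  ct_di : forall a, sing_boundary X (ct_i a) = 0;
  ct_pi : forall a, ct_p (ct_i a) = a;
  ct_ph : forall x, ct_p (ct_h x) = 0;
  ct_hi : forall a, ct_h (ct_i a) = 0;
  ct_hh : forall x, ct_h (ct_h x) = 0;
  ct_homotopy : forall x,
    ct_h (sing_boundary X x) + sing_boundary X (ct_h x) = ct_i (ct_p x) - x
}.

Section Transfer.
Context (X : topologicalType) (c : chain_contraction X).
Local Notation p := (ct_p c).
Local Notation i := (ct_i c).
Local Notation h := (ct_h c).

(* The value at [x] of the sum over [k + l = n], with [k, l >= 1], of
   [(-1)^(l (k - 1)) (P_k (x) P_l) Delta], where [Delta] is
   the Alexander-Whitney diagonal and [P_l] has degree [l - 1]: the power of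
   [parity] is the Koszul sign of [(P_k (x) P_l) (a (x) b)]. *)
Definition split_sum (P : nat -> chain X -> tensor (Hsing X)) (n : nat)
    (x : chain X) : tensor (Hsing X) :=
  \sum_(1 <= k < n) (-1) ^+ ((n - k) * k.-1)%N *:
    tmap2 (P k \o iter (n - k).-1%N (parity X)) (P (n - k)%N) (aw_diagonal X x).

(* [m] is a recursion bound; see [transfer_pE]. *)
Fixpoint transfer_p_rec (m n : nat) (x : chain X) : tensor (Hsing X) :=
  if m is m'.+1 then
    if n == 1%N then tword [:: p x] else split_sum (transfer_p_rec m') n (h x)
  else 0.

(* The components of the A-infinity morphism extending [p]. *)
Definition transfer_p (n : nat) : chain X -> tensor (Hsing X) := transfer_p_rec n n.

(* The operations of the transferred A-infinity coalgebra structure on [Hsing X], as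
   maps to the tensor power of order [n] inside the tensor algebra: the sum over
   planar binary trees with [n] leaves of the composites with [i] at the root,
   the Alexander-Whitney diagonal at the vertices, [h] at the inner edges and
   [p] at the leaves. The signs are those for which
     sum_(j, k) (-1)^(j + k + j k) (1^(n-j-k) (x) Delta_j (x) 1^k) Delta_(n-j+1)
   vanishes. *)
Definition transfer (n : nat) (a : Hsing X) : tensor (Hsing X) :=
  split_sum transfer_p n (i a).

Lemma transfer1 a : transfer 1 a = 0.
Proof. by rewrite /transfer /split_sum big_geq. Qed.

Lemma split_sum_ext (P Q : nat -> chain X -> tensor (Hsing X)) n x :
  (forall k, (0 < k < n)%N -> P k = Q k) -> split_sum P n x = split_sum Q n x.
Proof.
move=> PQ; rewrite /split_sum !big_nat; apply: eq_bigr => k kn.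
rewrite PQ // PQ //; case/andP: kn => k0 kn.
by rewrite subn_gt0 kn -[X in (_ < X)%N](subnKC (ltnW kn)) 
   -[X in (X < _)%N]add0n ltn_add2r.
Qed.

Lemma transfer_p_recE m n : (n <= m)%N -> transfer_p_rec m n = transfer_p n.
Proof.
rewrite /transfer_p; move: n; elim/ltn_ind: m => -[|m] IH n nm.
  by move: nm; rewrite leqn0 => /eqP ->.
apply/funext => x; case: n nm => [|n] nm /=.
  by rewrite /split_sum big_geq.
case: ifP => // _; apply: split_sum_ext => k /andP[k0 kn].
rewrite !IH //; first exact: leq_trans kn nm.
Qed.

Lemma transfer_pE n x : transfer_p n x =
  if n == 1%N then tword [:: p x] else split_sum transfer_p n (h x).
Proof.
case: n => [|n]; first by rewrite /split_sum big_geq.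
rewrite /transfer_p /=; case: ifP => // _.
by apply: split_sum_ext => k /andP[k0 kn]; rewrite transfer_p_recE.
Qed.

Lemma iter_parity_linear n : linear (iter n (parity X)).
Proof. by elim: n => [|n IHn] a x y //=; rewrite IHn linearP. Qed.

Lemma split_sum_linear (P : nat -> chain X -> tensor (Hsing X)) n :
  (forall k, (0 < k < n)%N -> linear (P k)) -> linear (split_sum P n).
Proof.
move=> PL a x y; rewrite /split_sum scaler_sumr -big_split /= !big_nat.
apply: eq_bigr => k kn.
have PkL : linear (P k \o iter (n - k).-1%N (parity X)).
  by move=> b u v; rewrite /= iter_parity_linear PL.
have PlL : linear (P (n - k)%N).
  apply: PL; case/andP: kn => k0 kn.
  by rewrite subn_gt0 kn ltn_subrL k0 (leq_trans _ kn).
rewrite linearP (tmap2_linear PkL PlL) scalerDr !scalerA.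
by rewrite mulrC.
Qed.

Lemma transfer_p_linear n : linear (transfer_p n).
Proof.
elim/ltn_ind: n => n IH a x y; rewrite !transfer_pE.
case: ifP => _.
  rewrite linearP; exact: (@tword_multilin _ _ [::] [::]).
by rewrite linearP split_sum_linear // => k /andP[_]; exact: IH.
Qed.

Lemma transfer_linear n : linear (transfer n).
Proof.
move=> a x y; rewrite /transfer linearP split_sum_linear // => k _.
exact: transfer_p_linear.
Qed.

HB.instance Definition _ n := GRing.isLinear.Build F (Hsing X) (tensor (Hsing X)) *:%R
  (transfer n) (transfer_linear n).

End Transfer.

(** * Persistence *)

Record space_seq (N : nat) := SpaceSeq {
  space :> 'I_N.+1 -> topologicalType;
  arrow : forall i j : 'I_N.+1, j = i.+1 :> nat ->
    continuousType (space i) (space j)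
}.

Section Persistence.
Context (N : nat) (K : space_seq N).
Implicit Types i j k : 'I_N.+1.

Definition total_H : lmodType F := dirsum (fun i => Hsing (K i)).

Lemma ltn_prev m i j : j = (m + i).+1 :> nat -> (m + i < N.+1)%N.
Proof. by move=> e; rewrite ltnW // -e ltn_ord. Qed.

(* The composite of the [m] arrows from [K i] to [K j], for [j = m + i]. *)
Fixpoint composite (m : nat) i j : j = (m + i)%N :> nat ->
    continuousType (K i) (K j) :=
  match m with
  | 0 => fun e =>
      eq_rect i (fun j => continuousType (K i) (K j)) idfun j (val_inj (esym e))
  | m'.+1 => fun e =>
      let j' := Ordinal (ltn_prev e) in
      (@arrow N K j' j e) \o (@composite m' i j' erefl)
  end.

Definition persistence_map i j (ij : (i <= j)%N) : Hsing (K i) -> Hsing (K j) :=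
  H_map (composite (esym (subnK ij))).

Context (c : forall i, chain_contraction (K i)).

Definition Delta (n : nat) i : Hsing (K i) -> tensor (Hsing (K i)) := transfer (c i) n.

Definition persistent_group (n p : nat) i j (ij : (i <= j)%N) : set (Hsing (K j)) :=
  persistence_map ij @`
    [set a | H_deg p a /\ forall k (ik : (i <= k)%N), (k <= j)%N ->
       Delta n (persistence_map ik a) = 0].

Definition awake (n : nat) i (a : Hsing (K i)) j (ij : (i <= j)%N) : Prop :=
  [/\ a <> 0, persistence_map ij a <> 0 & Delta n (persistence_map ij a) = 0].

End Persistence.
End Chains.

(* Main.v *)
Require Import Defs.
From HB Require Import structures.
From mathcomp Require Import all_boot all_order all_algebra.
From mathcomp Require Import all_classical all_reals all_analysis.
From mathcomp Require Import freeg.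

Set Implicit Arguments.
Unset Strict Implicit.
Unset Printing Implicit Defensive.

Import GRing.Theory.

Local Open Scope classical_set_scope.
Local Open Scope ring_scope.

(** The condition on the basis only involves, for each source index [i]
    separately, the vectors that lie in the summand [H_*(K_i)]. So a basis may
    be chosen in every summand independently, and their union is the basis of
    the direct sum ([dirsum_basis]).

    Fix [i] and put [A_j] for the space of classes [a] of degree [p] in
    [H_*(K_i)] with [Delta_n f^{i,k} a = 0] for all [k] between [i] and [j]. The
    spaces [A_j] decrease with [j]; the kernels of [f^{i,j}] increase with [j],
    because [f^{i,j}] factors through [f^{i,k}] for [k <= j]
    ([persistence_ker_mono]). Two flags of subspaces of one vector space always
    have a common adapted basis, that is, a basis whose intersection with any
    member of either flag spans this member ([two_flag_basis]). Let [B_i] be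
    such a basis for the flags of the [A_j] and of the kernels.

    The persistent group from [i] to [j] is the image of [A_j] by [f^{i,j}].
    As [B_i] is adapted both to [A_j] and to the kernel of [f^{i,j}], the map
    [f^{i,j}] is injective on the vectors of [B_i] that lie in [A_j] and outside
    the kernel, and their images form a basis of the persistent group
    ([image_inj], [image_basis]). Since the kernels increase, these vectors are
    exactly the ones of [B_i] in degree [p] which are awake at all [K_k] from
    [i] to [j]. There are finitely many of them because they are independent
    in the finite dimensional space [H_p(K_i)] ([finite_lin_indep]).

    The two-flag basis is built one pair of flag members at a time, in
    lexicographic order: [adapted_extend] enlarges an independent set by
    vectors of the current intersection of two members, which keeps it adapted
    to the second flag. The whole space is the last member of each flag, so the
    construction also yields bases of the homology in all degrees, possibly of
    infinite dimension. The extension of independent sets rests on Zorn's lemma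
    ([lin_indep_extend]). *)

(** * Spans and linear independence *)

Section LinearAlgebra.
Context (F : fieldType).

Section Span.
Context (V : lmodType F).
Implicit Types (B C S W : set V) (s t : seq V) (c : V -> F).

Definition subspace_set W : Prop :=
  W 0 /\ forall a x y, W x -> W y -> W (a *: x + y).

Lemma subspace_setB W x y : subspace_set W -> W x -> W y -> W (x - y).
Proof.
by move=> sW Wx Wy; rewrite addrC -scaleN1r; apply: sW.2.
Qed.

(** Linear combinations over different lists can be compared or added once they
    are written over a common list. *)
Lemma sum_extend s t c : uniq s -> uniq t -> {subset s <= t} ->
  \sum_(v <- s) c v *: v = \sum_(v <- t) (if v \in s then c v else 0) *: v.
Proof.
move=> us ut st.
rewrite [RHS](eq_bigr (fun v => if v \in s then c v *: v else 0)); last first.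
  by move=> v _; case: ifP; rewrite // scale0r.
rewrite -big_mkcond -big_filter; apply/perm_big/uniq_perm => //.
  exact: filter_uniq.
by move=> v; rewrite mem_filter andb_idr // => /st.
Qed.

Lemma lin_span_uniq B w : lin_span B w -> exists s c,
  [/\ uniq s, forall v, v \in s -> B v & w = \sum_(v <- s) c v *: v].
Proof.
move=> [s [c [sB ->]]].
exists (undup s), (fun v => c v *+ count_mem v s); split.
- exact: undup_uniq.
- by move=> v; rewrite mem_undup; exact: sB.
- rewrite -big_undup_iterop_count; apply: eq_bigr => v _.
  by rewrite -scalerMnl.
Qed.

Lemma lin_span_sub B : B `<=` lin_span B.
Proof.
move=> v Bv; exists [:: v], (fun=> 1); split; last first.
  by rewrite big_seq1 scale1r.
by move=> u; rewrite inE => /eqP ->.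
Qed.

Lemma lin_span_subspace B : subspace_set (lin_span B).
Proof.
split; first by exists [::], (fun=> 0); rewrite big_nil.
move=> a x y /lin_span_uniq[s [c [us sB ->]]] /lin_span_uniq[t [e [ut tB ->]]].
have ur : uniq (undup (s ++ t)) by exact: undup_uniq.
rewrite (sum_extend c us ur); last first.
  by move=> v vs; rewrite mem_undup mem_cat vs.
rewrite (sum_extend e ut ur); last first.
  by move=> v vt; rewrite mem_undup mem_cat vt orbT.
exists (undup (s ++ t)), (fun v =>
  a * (if v \in s then c v else 0) + (if v \in t then e v else 0)).
split=> [v|]; first by rewrite mem_undup mem_cat => /orP[/sB|/tB].
rewrite scaler_sumr -big_split /=; apply: eq_bigr => v _.
by rewrite scalerA scalerDl.
Qed.

Lemma lin_span_min B W : subspace_set W -> B `<=` W -> lin_span B `<=` W.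
Proof.
move=> [W0 WL] BW _ [s [c [sB ->]]].
elim: s sB => [|v s IH] sB; first by rewrite big_nil.
rewrite big_cons; apply: WL; first by apply/BW/sB; rewrite mem_head.
by apply: IH => u us; apply: sB; rewrite inE us orbT.
Qed.

Lemma lin_span_mono B C : B `<=` C -> lin_span B `<=` lin_span C.
Proof.
move=> BC; apply: lin_span_min; first exact: lin_span_subspace.
by move=> v /BC; exact: lin_span_sub.
Qed.

Lemma lin_spanU B C x : lin_span (B `|` C) x ->
  exists2 y, lin_span B y & lin_span C (x - y).
Proof.
have [B0 BL] := lin_span_subspace B; have [C0 CL] := lin_span_subspace C.
apply: (lin_span_min
  (W := [set x | exists2 y, lin_span B y & lin_span C (x - y)])).
  split=> [|a u v [y By Cy] [z Bz Cz]]; first by exists 0; rewrite ?subrr.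
  exists (a *: y + z); first exact: BL.
  by rewrite opprD addrACA -scalerBr; exact: CL.
move=> v [Bv|Cv]; last by exists 0; rewrite // subr0; exact: lin_span_sub.
by exists v; rewrite ?subrr //; exact: lin_span_sub.
Qed.

(** Subtracting from the combination its expression over [B'] leaves a linear
    relation in which [v] keeps its coefficient. *)
Lemma lin_indep_coef B B' s c v : lin_indep B -> B' `<=` B -> uniq s ->
  (forall u, u \in s -> B u) -> lin_span B' (\sum_(u <- s) c u *: u) ->
  v \in s -> ~ B' v -> c v = 0.
Proof.
move=> iB BB us sB /lin_span_uniq[t [e [ut tB']]] + vs nB'v.
have ur : uniq (undup (s ++ t)) by exact: undup_uniq.
rewrite (sum_extend c us ur); last first.
  by move=> x xs; rewrite mem_undup mem_cat xs.
rewrite (sum_extend e ut ur); last first.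
  by move=> x xt; rewrite mem_undup mem_cat xt orbT.
move=> /eqP; rewrite -subr_eq0 -sumrB => /eqP.
under eq_bigr do rewrite -scalerBl.
have rB x : x \in undup (s ++ t) -> B x.
  by rewrite mem_undup mem_cat => /orP[/sB|/tB' /BB].
move=> /(iB _ _ ur rB) /(_ v); rewrite mem_undup mem_cat vs /=.
by case: ifPn => [/tB'//|_]; rewrite subr0; apply.
Qed.

Lemma lin_indep_sub B B' : B' `<=` B -> lin_indep B -> lin_indep B'.
Proof. by move=> BB iB s c us sB'; apply: iB => // v /sB' /BB. Qed.

Lemma lin_indep0 : lin_indep (set0 : set V).
Proof. by move=> s c us s0 _ v /s0. Qed.

Lemma lin_indepU1 B v : lin_indep B -> ~ lin_span B v -> lin_indep (v |` B).
Proof.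
move=> iB nBv s c us sB s0.
have remB u : u \in rem v s -> B u.
  move=> us'; have := mem_rem us' => /sB[] // uv.
  by move: us'; rewrite uv mem_rem_uniqF.
have [vs|vs] := boolP (v \in s); last first.
  apply: (iB s c us _ s0) => u us'; have [] := sB _ us' => // uv.
  by move: vs; rewrite -uv us'.
have s0' : c v *: v + \sum_(u <- rem v s) c u *: u = 0.
  by move: s0; rewrite (perm_big _ (perm_to_rem vs)) big_cons.
have spr : lin_span B (\sum_(u <- rem v s) c u *: u) by exists (rem v s), c.
have cv0 : c v = 0.
  apply/eqP/negP => /negP cv; apply: nBv.
  have -> : v = - (c v)^-1 *: \sum_(u <- rem v s) c u *: u + 0.
    rewrite -(addKr (c v *: v) (\sum_(_ <- _) _)) s0' !addr0 scalerN scaleNr.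
    by rewrite opprK scalerA mulVf // scale1r.
  by have [z L] := lin_span_subspace B; apply: L.
move: s0'; rewrite cv0 scale0r add0r => s0' u us'.
have [->|uv] := eqVneq u v; first by [].
apply: (iB (rem v s)) => //; first exact: rem_uniq.
by rewrite mem_rem_uniq // !inE uv us'.
Qed.

(** Independence is a condition on finite lists, and a finite list of elements
    of the union of a chain already lies in one member: this is what makes the
    union of a chain of independent sets independent. When the chain is empty
    only the first alternative remains. *)
Lemma seq_in_chain_member (B : set V) (FF : set (set V)) s :
  total_on FF subset -> (forall v, v \in s -> (B `|` \bigcup_(X in FF) X) v) ->
  (forall v, v \in s -> B v) \/
  (exists2 X, FF X & forall v, v \in s -> (B `|` X) v).
Proof.
move=> tot; elim: s => [|v s IH] sB; first by left.
have {}IH := IH (fun u us => sB u (mem_behead (us : u \in behead (v :: s)))).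
have [Bv|[X FX Xv]] := sB v (mem_head _ _).
  case: IH => [IH|[X FX IH]].
    by left=> u; rewrite inE => /orP[/eqP ->|/IH].
  right; exists X => // u; rewrite inE => /orP[/eqP ->|/IH //].
  by left.
right; case: IH => [IH|[Y FY IH]].
  exists X => // u; rewrite inE => /orP[/eqP ->|/IH ?]; by [right|left].
have [XY|YX] := tot _ _ FX FY.
  exists Y => // u; rewrite inE => /orP[/eqP ->|/IH //].
  by right; apply: XY.
exists X => // u; rewrite inE => /orP[/eqP ->|/IH [?|/YX ?]]; by [right|left].
Qed.

(** A maximal subset of [S] that is independent together with [B] must span [S]
    together with [B]: any vector outside the span could be added to it. *)
Lemma lin_indep_extend B S : lin_indep B -> exists B',
  [/\ lin_indep (B `|` B'), B' `<=` S & S `<=` lin_span (B `|` B')].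
Proof.
move=> iB; pose P := [set X : set V | X `<=` S /\ lin_indep (B `|` X)].
have [|X [[XS iX] maxX]] := @Zorn_bigcup V P.
  move=> FF FP tot; split=> [x [X /FP[XS _] /XS]//|].
  move=> s c us sB s0.
  have [sB'|[X /FP[_ iX] sX]] := seq_in_chain_member tot sB; first exact: iB.
  exact: iX.
exists X; split=> // v Sv; apply: contrapT => nv.
apply: (maxX (v |` X)).
  split=> [x|/(_ v) vX]; first by right.
  by apply/nv/lin_span_sub; right; apply: vX; left.
split=> [x [->//|/XS//]|].
by rewrite setUCA; apply: lin_indepU1.
Qed.

(** * Bases adapted to two flags *)

Definition adapted B W : Prop := lin_span B `&` W `<=` lin_span (B `&` W).

(** One step of the construction. The span of [B] already contains [G `&` E u]
    for [u < t], and the new vectors are taken in [G `&` E t]. For [u < t] no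
    new vector is needed to reach the elements of [E u]; for [t <= u] all new
    vectors lie in [E u], so an element of [E u] in the new span differs by
    new vectors from an element of [E u] in the old span. Hence adaptedness
    to the whole flag [E] is preserved. *)
Lemma adapted_extend B (G : set V) (E : nat -> set V) (t : nat) :
  lin_indep B -> B `<=` G -> subspace_set G -> (forall u, subspace_set (E u)) ->
  {homo E : u v / leq u v >-> u `<=` v} ->
  (forall u, adapted B (E u)) ->
  (forall u, (u < t)%N -> G `&` E u `<=` lin_span B) ->
  exists B', [/\ B `<=` B', lin_indep B', B' `<=` G,
    forall u, adapted B' (E u) & G `&` E t `<=` lin_span B'].
Proof.
move=> iB BG sG sE homE adB old.
have [C [iC CS SC]] := lin_indep_extend (G `&` E t) iB.
exists (B `|` C); split=> //.
  by move=> v [/BG|/CS[]].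
move=> u x [Bx Ex].
have [ut|tu] := ltnP u t.
  have Gx : G x by apply: lin_span_min Bx => // v [/BG|/CS[]].
  apply: (@lin_span_mono (B `&` E u)); first by apply: setSI => v; left.
  by apply: adB; split=> //; apply: (old u).
have [y By Cxy] := lin_spanU Bx.
have CE : C `<=` E u by move=> v /CS[_]; apply: homE.
have Exy : E u (x - y) by apply: lin_span_min Cxy.
have Ey : E u y by rewrite -(subKr x y); apply: subspace_setB.
have [_ L] := lin_span_subspace ((B `|` C) `&` E u).
rewrite -(subrK y x) -[x - y]scale1r; apply: L.
  by apply: lin_span_mono Cxy => v Cv; split; [right|apply: CE].
have := adB u y (conj By Ey); apply: lin_span_mono.
by apply: setSI => v; left.
Qed.

(** Running through the flag [E] up to the whole space turns [B] into a basis of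
    [G] while remaining adapted to [E]. *)
Lemma adapted_extend_full B (G : set V) (E : nat -> set V) T :
  lin_indep B -> B `<=` G -> subspace_set G -> (forall u, subspace_set (E u)) ->
  {homo E : u v / leq u v >-> u `<=` v} ->
  E T = [set: V] ->
  (forall u, adapted B (E u)) ->
  exists B', [/\ B `<=` B', lin_indep B', B' `<=` G,
    forall u, adapted B' (E u) & G `<=` lin_span B'].
Proof.
move=> iB BG sG sE homE ET adB.
suff [B' [BB' iB' B'G adB' full]] : exists B',
    [/\ B `<=` B', lin_indep B', B' `<=` G, forall u, adapted B' (E u) &
        forall u, (u < T.+1)%N -> G `&` E u `<=` lin_span B'].
  exists B'; split=> // x Gx; apply: (full T) => //.
  by split=> //; rewrite ET.
elim: T.+1 => [|t [B1 [BB1 iB1 B1G adB1 old]]].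
  by exists B; split.
have [B2 [B12 iB2 B2G adB2 new]] := adapted_extend iB1 B1G sG sE homE adB1 old.
exists B2; split=> // [|u]; first exact: subset_trans BB1 B12.
rewrite ltnS leq_eqVlt => /orP[/eqP -> //|/old ut].
exact: subset_trans (lin_span_mono B12).
Qed.

(** Both flags end with the whole space, so adaptedness to their last members
    says that the adapted independent set is a basis. *)
Lemma two_flag_basis (G E : nat -> set V) M T :
  (forall s : nat, subspace_set (G s)) -> (forall t : nat, subspace_set (E t)) ->
  {homo G : u v / leq u v >-> u `<=` v} ->
  {homo E : u v / leq u v >-> u `<=` v} ->
  G M = [set: V] -> E T = [set: V] ->
  exists B, [/\ set_basis_of [set: V] B,
    forall s : nat, (s <= M)%N -> adapted B (G s) &
    forall t : nat, adapted B (E t)].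
Proof.
move=> sG sE homG homE GM ET.
(* [M.+1] counts the members of [G] already treated, and the set built from
   the first [m] of them lies in the last one, [G m.-1]; for [m = 0] the empty
   set satisfies this by the convention [0.-1 = 0]. *)
suff [B [iB BG adE full]] : exists B,
    [/\ lin_indep B, B `<=` G M.+1.-1, forall t : nat, adapted B (E t) &
        forall s : nat, (s < M.+1)%N -> G s `<=` lin_span (B `&` G s)].
  exists B; split=> // [|s sM x [_]]; last exact: full.
  split=> // x _; apply: (@lin_span_mono (B `&` G M)); first by move=> ? [].
  by apply: full => //; rewrite GM.
elim: M.+1 => [|m [B [iB BG adB old]]].
  exists set0; split=> //; first exact: lin_indep0.
  by move=> t x [x0 _]; rewrite set0I.
have BGm : B `<=` G m by move=> v /BG; apply: homG; exact: leq_pred.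
have [B' [BB' iB' B'G adB' full]] :=
  adapted_extend_full iB BGm (sG m) sE homE ET adB.
exists B'; split=> // s; rewrite ltnS leq_eqVlt => /orP[/eqP ->|/old sm].
  by rewrite (setIidl B'G).
by apply: subset_trans (lin_span_mono _); [exact: sm|apply: setSI].
Qed.

(** * Independent sets in finite dimension *)

(** If [s] were longer than [t], the matrix of the coordinates of [s] on [t]
    would have more rows than columns, and a nonzero vector of its left kernel
    would be a linear relation between the elements of [s]. *)
Lemma size_lin_indep s t : uniq s -> uniq t -> lin_indep [set` s] ->
  (forall v, v \in s -> lin_span [set` t] v) -> (size s <= size t)%N.
Proof.
move=> us ut is_ st; rewrite leqNgt; apply/negP => ts.
have /choice[A sA] : forall i : 'I_(size s), exists a : 'I_(size t) -> F,
    s`_i = \sum_j a j *: t`_j.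
  move=> i.
  have /st/lin_span_uniq[r [c [ur rt ->]]] : s`_i \in s by exact: mem_nth.
  rewrite (sum_extend c ur ut rt) (big_nth 0) big_mkord.
  by exists (fun j => if t`_j \in r then c t`_j else 0).
have : kermx (\matrix_(i, j) A i j) != 0.
  rewrite kermx_eq0; apply/negP => /eqP rk.
  by have := rank_leq_col (\matrix_(i, j) A i j); rewrite rk leqNgt ts.
move=> /rowV0Pn[u /sub_kermxP uA /eqP]; apply; apply/rowP => k; rewrite mxE.
pose c v := if insub (index v s) is Some i then u 0 i else 0.
have cE (i : 'I_(size s)) : c s`_i = u 0 i.
  by rewrite /c index_uniq // valK.
rewrite -cE; apply: (is_ s c us) => //; last exact: mem_nth.
rewrite (big_nth 0) big_mkord.
under eq_bigr do rewrite cE sA scaler_sumr.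
rewrite exchange_big big1 // => j _.
under eq_bigr do rewrite scalerA.
rewrite -scaler_suml; have /rowP/(_ j) := uA; rewrite !mxE.
by under eq_bigr do rewrite mxE; move=> ->; rewrite scale0r.
Qed.

Lemma finite_lin_indep W B : finite_dim W -> B `<=` W -> lin_indep B ->
  finite_set B.
Proof.
move=> [C [_ iC WC] /finite_seqP[t tC]] BW iB; apply: contrapT => infB.
have [X XB] := infinite_set_fset (size (undup t)).+1 infB.
rewrite leqNgt => /negP; apply; rewrite ltnS.
apply: size_lin_indep; [exact: finmap.fset_uniq|exact: undup_uniq|..].
  exact: lin_indep_sub iB.
move=> v vX; have : lin_span C v by apply/WC/BW/XB.
by apply: lin_span_mono; rewrite tC => x /=; rewrite mem_undup.
Qed.

End Span.

(** * Images of adapted bases *)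

Section Image.
Context (V W : lmodType F) (f : {linear V -> W}) (B A : set V).
Hypotheses (basB : set_basis_of [set: V] B) (adA : adapted B A).
Hypothesis (adK : adapted B [set x | f x = 0]).

Let C : set V := [set v | [/\ B v, A v & f v <> 0]].

(** A combination of vectors of [C] in the kernel is, by adaptedness, a
    combination of basis vectors in the kernel, none of which is in [C]. *)
Lemma lin_comb_ker_eq0 s (c : V -> F) : uniq s -> (forall v, v \in s -> C v) ->
  f (\sum_(v <- s) c v *: v) = 0 -> forall v, v \in s -> c v = 0.
Proof.
move=> us sC f0 v vs; case: basB => _ iB _.
apply: (lin_indep_coef iB (B' := B `&` [set x | f x = 0]) (s := s)) => //.
- by move=> u /sC[].
- by apply: adK; split=> //; case: basB => _ _; apply.
- by move=> [_ fv]; have [_ _] := sC v vs.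
Qed.

Lemma image_inj : {in C &, injective f}.
Proof.
move=> u v /set_mem Cu /set_mem Cv fuv; apply/eqP/negP => /negP uv.
suff /eqP : (if u == u then 1 else -1) = 0 :> F by rewrite eqxx oner_eq0.
apply: (@lin_comb_ker_eq0 [:: u; v] (fun x => if x == u then 1 else -1)).
- by rewrite /= inE uv.
- by move=> x; rewrite !inE => /orP[] /eqP ->.
- rewrite big_cons big_seq1 eqxx eq_sym (negbTE uv) scale1r scaleN1r.
  by rewrite linearB /= fuv subrr.
- exact: mem_head.
Qed.

(** The vectors of [B] in [A] span [A]; those in the kernel contribute nothing to
    the image, and the images of the others are independent. *)
Lemma image_basis : set_basis_of (f @` A) (f @` C).
Proof.
split.
- by move=> _ [v [_ Av _] <-]; exists v.
- move=> s c us sC s0 w ws.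
  have /choice[g gP] : forall w, exists v, w \in s -> C v /\ f v = w.
    move=> x; have [/sC[v Cv <-]|nx] := boolP (x \in s); first by exists v.
    by exists 0.
  have -> : w = f (g w) by have [] := gP w ws.
  apply: (@lin_comb_ker_eq0 [seq g x | x <- s] (c \o f)); last exact: map_f.
  + rewrite map_inj_in_uniq // => x y /gP[_ fx] /gP[_ fy] gxy.
    by rewrite -fx -fy gxy.
  + by move=> _ /mapP[x /gP[Cx _] ->].
  + rewrite big_map linear_sum /= -[RHS]s0 !big_seq.
    apply: eq_bigr => x /gP[_ fx].
    by rewrite linearZ /= fx.
- move=> _ [x Ax <-].
  have [z L] := lin_span_subspace (f @` C).
  apply: (lin_span_min (B := B `&` A) (W := [set x | lin_span (f @` C) (f x)])).
  + split=> [/=|a u v Su Sv /=]; first by rewrite linear0.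
    by rewrite linearP; apply: L.
  + move=> v [Bv Av] /=.
    have [->//|fv] := pselect (f v = 0).
    by apply: lin_span_sub; exists v.
  + by apply: adA; split=> //; case: basB => _ _; apply.
Qed.

End Image.

(** * Bases of finite direct sums *)

Section DirectSum.
Context (I : finType) (V : I -> lmodType F).

Lemma dsinjE i (v : V i) : dsinj V i v i = v.
Proof.
by rewrite /dsinj; case: eqP => // e; rewrite (eq_irrelevance e erefl).
Qed.

Lemma dsinjN i j (v : V i) : i <> j -> dsinj V i v j = 0.
Proof. by rewrite /dsinj; case: eqP. Qed.

Lemma dsinj_inj i : injective (dsinj V i).
Proof. by move=> u v /(congr1 (fun x : dirsum V => x i)); rewrite !dsinjE. Qed.

Lemma dsinj_linear i : linear (dsinj V i).
Proof.
move=> a u v; apply: functional_extensionality_dep => j.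
have E (x y : dirsum V) : (a *: x + y) j = a *: x j + y j by [].
rewrite E; have [e|ne] := pselect (i = j); last first.
  by rewrite !dsinjN // scaler0 addr0.
by case: j / e E => _; rewrite !dsinjE.
Qed.

Lemma dirsum_sumE (T : Type) (r : seq T) (h : T -> dirsum V) i :
  (\sum_(t <- r) h t) i = \sum_(t <- r) h t i.
Proof.
elim: r => [|t r IH]; first by rewrite !big_nil.
by rewrite !big_cons -IH.
Qed.

(** A linear relation in the direct sum is tested one component at a time: in
    component [i] only the vectors injected from [V i] survive. *)
Lemma dirsum_basis (B : forall i, set (V i)) :
  (forall i, set_basis_of [set: V i] (B i)) ->
  set_basis_of [set: dirsum V] (\bigcup_i (dsinj V i @` B i)).
Proof.
move=> basB; split=> //.
- move=> s c us sB s0 v vs; have [i _ [a Ba av]] := sB v vs.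
  pose D := [seq w <- s | w \in dsinj V i @` B i].
  have DE w : w \in D -> w \in s /\ exists2 b, B i b & dsinj V i b = w.
    by rewrite mem_filter => /andP[/set_mem].
  have <- : (c \o dsinj V i) a = c v by rewrite /= av.
  have [_ iB _] := basB i.
  apply: (iB [seq w i | w : dirsum V <- D]).
  + rewrite map_inj_in_uniq ?filter_uniq // => x y.
    by move=> /DE[_ [b _ <-]] /DE[_ [b' _ <-]]; rewrite !dsinjE => ->.
  + by move=> _ /mapP[x /DE[_ [b Bb <-]] ->]; rewrite dsinjE.
  + have /(congr1 (fun x : dirsum V => x i)) := s0.
    rewrite dirsum_sumE => s0i; rewrite big_map big_filter -[RHS]s0i.
    rewrite big_mkcond /= !big_seq; apply: eq_bigr => x xs.
    have E (e : F) (w : dirsum V) : (e *: w) i = e *: w i by [].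
    rewrite E; case: ifPn => [/set_mem[b _ <-]|nx]; first by rewrite dsinjE.
    have [l _ [b Bb bx]] := sB x xs; rewrite -bx.
    rewrite dsinjN ?scaler0 // => li; move/negP: nx; apply.
    by rewrite inE; case: i / li {iB D DE E s0i Ba av a} => //; exists b.
  + apply/mapP; exists v; last by rewrite -av dsinjE.
    by rewrite mem_filter vs andbT inE; exists a.
- move=> x _; have -> : x = \sum_i dsinj V i (x i).
    apply: functional_extensionality_dep => j; rewrite dirsum_sumE (bigD1 j) //=.
    rewrite dsinjE big1 ?addr0 // => i /eqP ij.
    by rewrite dsinjN.
  have [z L] := lin_span_subspace (\bigcup_i (dsinj V i @` B i)).
  apply: (big_ind (lin_span _)) => // [u v su sv|i _].
    by rewrite -[u]scale1r; apply: L.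
  have [_ _ /(_ (x i) Logic.I)] := basB i.
  apply: (lin_span_min (W := [set a | lin_span _ (dsinj V i a)])).
    split=> [/=|a u v su sv /=]; last by rewrite dsinj_linear; apply: L.
    suff -> : dsinj V i 0 = 0 by [].
    apply: functional_extensionality_dep => j; rewrite /dsinj.
    by case: eqP => // e; case: j / e.
  by move=> a Ba /=; apply: lin_span_sub; exists i => //; exists a.
Qed.

End DirectSum.

End LinearAlgebra.

(** * Homology as a functor, and its degrees *)

Section Homology.
Context (R : realType) (F : fieldType).

Lemma H_deg_subspace (X : topologicalType) p : subspace_set (@H_deg R F X p).
Proof.
split; first by exists 0; [by move=> s; rewrite /= coeff0 eqxx|exact: linear0].
move=> a _ _ [z zp <-] [z' z'p <-]; exists (a *: z + z'); last exact: linearP.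
move=> s /=; rewrite coeffD coeffZ => zz'.
have [//|sp] := pselect (tag s = p); move: zz'.
have -> : coeff s (cycle_val z) = 0.
  by apply/eqP/negP => /negP /zp.
have -> : coeff s (cycle_val z') = 0.
  by apply/eqP/negP => /negP /z'p.
by rewrite mulr0 addr0 eqxx.
Qed.

Lemma chain_map_comp (X Y Z : topologicalType) (f : continuousType X Y)
    (g : continuousType Y Z) (x : chain R F X) :
  chain_map R F (g \o f : continuousType X Z) x =
  chain_map R F g (chain_map R F f x).
Proof.
rewrite -[x]freeg_sumE; elim: (dom x) => [|s r IH].
  by rewrite big_nil !linear0.
rewrite big_cons !linearD /= IH; congr (_ + _).
rewrite /= !liftU !(linearZ_LR (fglift _)) /= liftU scale1r; congr (_ *: << _ >>).
by congr (Tagged _ _); exact/continuousEP.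
Qed.

Lemma H_map_class (X Y : topologicalType) (f : continuousType X Y)
    (z : Defs.cycle (sing_boundary R F X)) :
  H_map f (hclass z) =
  hclass (Defs.cycle_map (sing_boundary R F Y) (chain_map R F f) z).
Proof. exact: (homology_map_class (@chain_map_boundary R F X Y f)). Qed.

Lemma H_map_comp (X Y Z : topologicalType) (f : continuousType X Y)
    (g : continuousType Y Z) (a : Hsing R F X) :
  H_map (g \o f : continuousType X Z) a = H_map g (H_map f a).
Proof.
rewrite -[a]qreprK -/(hclass (qrepr a)) !H_map_class.
congr hclass; apply: val_inj.
by rewrite /= !(cycle_mapE (chain_map_boundary (R:=R) (F:=F) _)) chain_map_comp.
Qed.

Context (N : nat) (K : space_seq N).

(** The longer composite is the shorter one followed by further arrows. The two
    lengths [m] and [m'] are independent variables, with equations on the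
    endpoints, so that induction on their difference moves [j] as well. *)
Lemma composite_ker_mono m m' (i k j : 'I_N.+1) (ek : k = (m + i)%N :> nat)
    (ej : j = (m' + i)%N :> nat) (a : Hsing R F (K i)) : (k <= j)%N ->
  H_map (composite K ek) a = 0 -> H_map (composite K ej) a = 0.
Proof.
move=> kj ak; have mm : (m <= m')%N by move: kj; rewrite ek ej leq_add2r.
rewrite -(subnK mm) in ej *.
elim: (m' - m)%N j ej {kj} => [|q IH] j ej.
  have jk : j = k by apply: val_inj; rewrite /= ek ej.
  by move: ej; rewrite jk => ej; rewrite (eq_irrelevance ej ek).
by rewrite H_map_comp IH linear0.
Qed.

End Homology.

(** * Bases adapted to persistence *)

Section Persistence.
Context (R : realType) (F : fieldType) (N : nat) (K : space_seq N).
Context (c : forall i : 'I_N.+1, chain_contraction R F (K i)) (n p : nat).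
Implicit Types i j k : 'I_N.+1.

Definition null_throughout i j : set (Hsing R F (K i)) :=
  [set a | H_deg p a /\ forall k (ik : (i <= k)%N), (k <= j)%N ->
     Delta c n (persistence_map ik a) = 0].

Lemma persistence_ker_mono i j k (ik : (i <= k)%N) (ij : (i <= j)%N)
    (a : Hsing R F (K i)) : (k <= j)%N ->
  persistence_map ik a = 0 -> persistence_map ij a = 0.
Proof. exact: composite_ker_mono. Qed.

Lemma persistence_map_linear i j (ij : (i <= j)%N) :
  linear (persistence_map (R := R) (F := F) (K := K) ij).
Proof. exact: linearP. Qed.

Lemma Delta_linear i : linear (Delta c n (i := i)).
Proof. exact: linearP. Qed.

(** The theorem on two flags, applied to the increasing flags [G s], equal to
    [null_throughout i (N - s)] for [i <= N - s], and [E t], equal to the kernel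
    of the map to [K_t] for [i <= t <= N]. *)
Lemma adapted_homology_basis i : exists B : set (Hsing R F (K i)),
  set_basis_of [set: Hsing R F (K i)] B /\
  forall j (ij : (i <= j)%N), adapted B (@null_throughout i j) /\
    adapted B [set a | persistence_map ij a = 0].
Proof.
(* Both flags are indexed by all natural numbers. From [N.+1] on, no index [k]
   satisfies the conditions, so that [G] and [E] are the whole space. *)
pose G (s : nat) : set (Hsing R F (K i)) :=
  [set a | forall k (ik : (i <= k)%N), (k + s <= N)%N ->
     H_deg p a /\ Delta c n (persistence_map ik a) = 0].
pose E (t : nat) : set (Hsing R F (K i)) :=
  [set a | forall k (ik : (i <= k)%N), (t <= k)%N -> persistence_map ik a = 0].
have f0 k (ik : (i <= k)%N) : persistence_map (R := R) (F := F) (K := K) ik 0 = 0.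
  exact: linear0.
have sG s : subspace_set (G s).
  split=> [k ik _|a x y Gx Gy k ik ks].
    split; first by have [] := @H_deg_subspace R F (K i) p.
    by rewrite f0 /Delta linear0.
  have [px dx] := Gx k ik ks; have [py dy] := Gy k ik ks.
  split; first by have [_] := @H_deg_subspace R F (K i) p; apply.
  by rewrite persistence_map_linear Delta_linear dx dy scaler0 addr0.
have sE t : subspace_set (E t).
  split=> [k ik _ //|a x y Ex Ey k ik tk].
  by rewrite persistence_map_linear Ex // Ey // scaler0 addr0.
have [|||| B [basB adG adE]] := two_flag_basis (M := N.+1) (T := N.+1) sG sE.
- move=> u v uv a Ga k ik kv; apply: Ga.
  by apply: leq_trans kv; rewrite leq_add2l.
- by move=> u v uv a Ea k ik vk; apply: Ea; exact: leq_trans vk.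
- by apply/seteqP; split=> // a _ k ik; rewrite addnS ltnNge leq_addl.
- by apply/seteqP; split=> // a _ k ik; rewrite leqNgt ltn_ord.
exists B; split=> // j ij; split.
  suff <- : G (N - j)%N = null_throughout j by apply: adG; rewrite leqW ?leq_subr.
  have Nj k : (k + (N - j) <= N)%N = (k <= j)%N.
    rewrite -[X in (_ <= X)%N](subnKC (_ : j <= N)%N) ?leq_add2r //.
    by rewrite -ltnS ltn_ord.
  apply/seteqP; split=> a.
    move=> Ga; split; first by have [|//] := Ga i (leqnn _); rewrite Nj.
    by move=> k ik kj; have [|//] := Ga k ik; rewrite Nj.
  by move=> [pa da] k ik; rewrite Nj => kj; split=> //; exact: da.
suff <- : E j = [set a | persistence_map ij a = 0] by exact: adE.
apply/seteqP; split=> a; first by apply.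
by move=> /= aj k ik jk; exact: persistence_ker_mono jk aj.
Qed.

End Persistence.

Theorem theorem2p7 (R : realType) (F : fieldType) (N : nat) (K : space_seq N)
    (c : forall i : 'I_N.+1, chain_contraction R F (K i))
    (Hfin : forall (i : 'I_N.+1) (q : nat), finite_dim (@H_deg R F (K i) q))
    (n p : nat) (hn : (1 <= n)%N) :
  exists B : set (total_H R F K),
    set_basis_of [set: total_H R F K] B /\
    forall (i j : 'I_N.+1) (ij : (i <= j)%N),
      exists d : nat,
        has_dim (persistent_group c n p ij) d /\
        ([set b : total_H R F K | B b /\
           exists a : Hsing R F (K i),
             [/\ H_deg p a, b = dsinj (fun l => Hsing R F (K l)) i a &
                 forall (k : 'I_N.+1) (ik : (i <= k)%N), (k <= j)%N ->
                   awake c n a ik]]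
         #= `I_d)%card.
Proof.
(* [B i] is a basis of the homology of [K i] adapted to both flags. *)
pose B i := projT1 (cid (adapted_homology_basis c n p i)).
have BP i := projT2 (cid (adapted_homology_basis c n p i)).
have basB i : set_basis_of [set: Hsing R F (K i)] (B i) by have [] := BP i.
exists (\bigcup_i (dsinj (fun l => Hsing R F (K l)) i @` B i)).
split=> [|i j ij]; first exact: (dirsum_basis (V := fun l => Hsing R F (K l))).
have [_ /(_ j ij) [adA adK]] := BP i.
pose f : {linear Hsing R F (K i) -> Hsing R F (K j)} :=
  H_map (composite K (esym (subnK ij))).
pose A : set (Hsing R F (K i)) := null_throughout c n p j.
pose C := [set v | [/\ B i v, A v & f v <> 0]].
have [d Cd] : finite_set C.
  apply: (finite_lin_indep (Hfin i p)) => [a [_ [] //]|].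
  by apply: (lin_indep_sub (B := B i)) => [a []//|]; have [] := basB i.
exists d; split.
  exists (f @` C); first exact: (image_basis (f := f) (basB i) adA adK).
  apply: card_eq_trans Cd; apply: inj_card_eq.
  exact: (image_inj (f := f) (basB i) adK).
(* The vectors counted are the images of [C] in the direct sum. *)
rewrite [X in (X #= _)%card](_ : _ = dsinj (fun l => Hsing R F (K l)) i @` C).
  apply: card_eq_trans Cd; apply: inj_card_eq => x y _ _.
  exact: (dsinj_inj (V := fun l => Hsing R F (K l))).
apply/seteqP; split=> [b|_ [a [Ba [pa da] fa] <-]].
  move=> [[l _ [a' Ba' ba']] [a [pa ba aw]]].
  have [a0 _ _] := aw i (leqnn _) ij.
  exists a => //; split.
  - (* [a] is nonzero, being awake, so [b] lies in a single summand. *)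
    have li : l = i.
      apply: contrapT => /(dsinjN (V := fun l => Hsing R F (K l)) a') a'0.
      apply: a0.
      by rewrite -(dsinjE (V := fun l => Hsing R F (K l)) a) -ba -ba' a'0.
    move: ba'; rewrite ba.
    case: i / li {BP basB a0 aw adA adK f A C Cd pa ba ij} a => a.
    by move=> /(dsinj_inj (V := fun l => Hsing R F (K l))) <-.
  - by split=> // k ik kj; have [] := aw k ik kj.
  - by have [] := aw j ij (leqnn _).
split; first by exists i => //; exists a.
exists a; split=> // k ik kj; split.
- by move=> a0; apply: fa; rewrite a0 linear0.
- by move=> fk; apply: fa; exact: persistence_ker_mono kj fk.
- exact: da.
Qed.
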